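(* Let $p$ be a prime, let $n\geq 1$ be an integer, and let $P(z)\in\mathbb C_p[z]$ be a polynomial of degree $n$ with roots $\lambda_1,\lambda_2,\dots,\lambda_n\in\mathbb C_p$ (listed with multiplicity). Let $a\in\mathbb C_p$ and let $r\geq 0$ be a real number such that $\lambda_1,\dots,\lambda_n\in D(a,r)$. Then for each $k=1,2,\dots,n-1$ the disk $D(a,r_k)$, where \[ r_k=\max\left\{\, r\left|\frac{j}{n}\right|^{\frac{1}{n-j}} \;:\; j=1,2,\dots,k\right\}, \] contains at least $k$ roots (counted with multiplicity) of the derivative $P'(z)$.
   Context: $\mathbb C_p$ denotes the completion of the algebraic closure of the field $\mathbb Q_p$ of $p$-adic numbers, with its norm $|\cdot|$ extending the $p$-adic norm (normalized by $|p|=1/p$); it is an algebraically closed non-Archimedean field. For integers $j,n$, $|j/n|$ denotes the ($p$-adic) norm of $j/n$ in $\mathbb C_p$. For $a\in\mathbb C_p$ and real $r\ge 0$, $D(a,r)=\{z\in\mathbb C_p : |z-a|\leq r\}$. The roots of the derivative are the elements $\omega_1,\dots,\omega_{n-1}\in\mathbb C_p$, listed with multiplicity, with $P'(z)=n a_n(z-\omega_1)\cdots(z-\omega_{n-1})$, where $a_n$ is the leading coefficient of $P$. *)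

(* Defs.v *)
From mathcomp Require Import all_boot all_order all_algebra.
From mathcomp Require Import reals exp.

Set Implicit Arguments.
Unset Strict Implicit.
Unset Printing Implicit Defensive.

Import Order.TTheory GRing.Theory Num.Theory.

Local Open Scope ring_scope.

(* MathComp's [normedZmodType] cannot be used for this: it requires
   [`|x *+ m| = `|x| *+ m], which fails for a p-adic norm. *)
Record ultrametricAbs (R : realType) (K : fieldType) := UltrametricAbs {
  uabs :> K -> R;
  uabs_ge0 : forall x, 0 <= uabs x;
  uabs_eq0 : forall x, uabs x = 0 <-> x = 0;
  uabsM : forall x y, uabs (x * y) = uabs x * uabs y;
  uabsD : forall x y, uabs (x + y) <= Num.max (uabs x) (uabs y)
}.

Section Completion.
Variables (R : realType) (K L : fieldType).

Definition isometric_to (absK : K -> R) (absL : L -> R) (i : K -> L) : Prop :=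
  forall x, absL (i x) = absK x.

Definition dense_image (absL : L -> R) (i : K -> L) : Prop :=
  forall (y : L) (e : R), 0 < e -> exists x : K, absL (y - i x) < e.

Definition abs_complete (absL : L -> R) : Prop :=
  forall u : nat -> L,
    (forall e : R, 0 < e -> exists N : nat, forall m m' : nat,
       (N <= m)%N -> (N <= m')%N -> absL (u m - u m') < e) ->
    exists l : L, forall e : R, 0 < e -> exists N : nat, forall m : nat,
       (N <= m)%N -> absL (u m - l) < e.

Definition is_completion (absK : K -> R) (absL : L -> R) (i : K -> L) : Prop :=
  [/\ isometric_to absK absL i, dense_image absL i & abs_complete absL].

End Completion.

Definition padic_abs (R : realType) (p : nat) (x : rat) : R :=
  if x == 0 then 0
  else p%:R ^ ((logn p `|denq x|)%:Z - (logn p `|numq x|)%:Z).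

(* [padicComplex R p] is the type of all realizations of C_p (unique up to
   isometric isomorphism when p is prime) as the completion of an algebraic
   closure [Qpbar] of a completion [Qp] of the rationals for the p-adic norm.
   The norms on [Qpbar] and [Cp] are determined by the one on [Qp].  That the
   completion of [Qpbar] is again algebraically closed is a classical fact; it
   is recorded in the structure of the carrier. *)
Record padicComplex (R : realType) (p : nat) := PadicComplex {
  Qp : fieldType;
  Qp_abs : ultrametricAbs R Qp;
  Qp_inj : {rmorphism rat -> Qp};
  Qp_completion : is_completion (padic_abs R p) Qp_abs Qp_inj;
  Qpbar : closedFieldType;
  Qpbar_abs : ultrametricAbs R Qpbar;
  Qpbar_inj : {rmorphism Qp -> Qpbar};
  Qpbar_isometric : isometric_to Qp_abs Qpbar_abs Qpbar_inj;
  Qpbar_algebraic : forall x : Qpbar, algebraicOver Qpbar_inj x;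
  Cp :> closedFieldType;
  Cp_abs : ultrametricAbs R Cp;
  Cp_inj : {rmorphism Qpbar -> Cp};
  Cp_completion : is_completion Qpbar_abs Cp_abs Cp_inj
}.

Definition disk (R : realType) (p : nat) (C : padicComplex R p) (a : C) (r : R)
    : pred C :=
  fun z => Cp_abs C (z - a) <= r.

(* The default value 0 of the iterated maximum is harmless: for [0 <= r] all the
   terms are nonnegative, and the range is nonempty when [0 < k]. *)
Definition crit_radius (R : realType) (p : nat) (C : padicComplex R p)
    (n : nat) (r : R) (k : nat) : R :=
  \big[Num.max/0]_(1 <= j < k.+1)
    (r * Cp_abs C (j%:R / n%:R) `^ (1 / (n - j)%:R)).

(* Main.v *)
(* Translate [a] to [0] and normalise [P] to a monic [Q], whose roots have norm
   at most [r].  Its coefficient of [X^j] has norm at most [r^(n-j)], hence the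
   coefficient of [X^(j-1)] in [Q'/n] has norm at most [|j/n| r^(n-j)].  If
   exactly [m < k] roots of [Q'] have norm at most [rho := r_k], the coefficient
   of [X^m] in [Q'/n] is dominated by the product of the [n-1-m >= 1] other
   roots, so its norm exceeds [rho^(n-1-m)].  With [j = m+1] this contradicts
   [rho >= r |j/n|^(1/(n-j))]. *)
Require Import Defs.
From mathcomp Require Import all_boot all_order all_algebra.
From mathcomp Require Import reals exp.

Set Implicit Arguments.
Unset Strict Implicit.
Unset Printing Implicit Defensive.

Import Order.TTheory GRing.Theory Num.Theory.

Local Open Scope ring_scope.

Section Ultrametric.
Variables (R : realType) (K : fieldType) (v : ultrametricAbs R K).

Lemma uabs0 : v 0 = 0.
Proof. exact/uabs_eq0. Qed.

Lemma uabs_neq0 x : x != 0 -> v x != 0.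
Proof. by apply: contraNneq => /uabs_eq0 ->. Qed.

Lemma uabs1 : v 1 = 1.
Proof.
apply: (mulfI (uabs_neq0 (oner_neq0 K))).
by rewrite -uabsM !mulr1.
Qed.

Lemma uabsN x : v (- x) = v x.
Proof.
suff h : v (-1) = 1 by rewrite -mulN1r uabsM h mul1r.
apply/eqP; rewrite -(@eqrXn2 _ 2) ?uabs_ge0 //.
by rewrite expr2 -uabsM mulrNN mulr1 uabs1 expr1n.
Qed.

Lemma uabsD_le x y c : v x <= c -> v y <= c -> v (x + y) <= c.
Proof. by move=> hx hy; apply: le_trans (uabsD v x y) _; rewrite ge_max hx. Qed.

Lemma uabsD_lt x y c : v x < c -> v y < c -> v (x + y) < c.
Proof.
by move=> hx hy; apply: le_lt_trans (uabsD v x y) _; rewrite gt_max hx.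
Qed.

Lemma uabs_sum_lt (I : Type) (s : seq I) (A : pred I) (F : I -> K) c :
  0 < c -> (forall i, A i -> v (F i) < c) -> v (\sum_(i <- s | A i) F i) < c.
Proof.
move=> c0 hF; apply: (big_ind (fun x => v x < c)) => //; first by rewrite uabs0.
by move=> x y; exact: uabsD_lt.
Qed.

(** Otherwise [x], as the difference of [x + y] and [y], would have norm below [v x]. *)
Lemma uabsD_dominant x y : v y < v x -> v (x + y) = v x.
Proof.
move=> hyx; apply/le_anti/andP; split; first exact: uabsD_le (ltW hyx).
rewrite leNgt; apply/negP => h.
suff : v x < v x by rewrite ltxx.
by rewrite -{1}(addrK y x); apply: uabsD_lt; rewrite ?uabsN.
Qed.

Lemma coef_XsubC_mul (x : K) (A : {poly K}) i :
  (('X - x%:P) * A)`_i = (if i is j.+1 then A`_j else 0) - x * A`_i.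
Proof. by rewrite mulrBl coefB coefXM coefCM; case: i. Qed.

(** Up to sign the coefficient is an elementary symmetric function of degree [size s - i] in the
    roots. For [i > size s] it vanishes, and the truncated exponent is harmless. *)
Lemma uabs_coef_prod_le (rho : R) (s : seq K) i :
  all (fun x => v x <= rho) s ->
  v (\prod_(x <- s) ('X - x%:P))`_i <= rho ^+ (size s - i).
Proof.
elim: s i => [|x s IHs] i /=.
  rewrite big_nil coef1 sub0n expr0 => _.
  by case: eqP => _; rewrite ?uabs1 ?uabs0.
move=> /andP[hx hs]; have rho0 : 0 <= rho := le_trans (uabs_ge0 v x) hx.
rewrite big_cons coef_XsubC_mul; apply: uabsD_le.
  case: i => [|i]; first by rewrite uabs0 exprn_ge0.
  by rewrite subSS IHs.
rewrite uabsN; case: (leqP i (size s)) => hi.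
  by rewrite uabsM subSn // exprS ler_pM ?uabs_ge0 ?IHs.
by rewrite nth_default ?mulr0 ?uabs0 ?exprn_ge0 // size_prod_XsubC.
Qed.

(** When all roots lie outside the disk of radius [rho], the constant term strictly dominates every
    other term on that disk. The last clause excludes the empty product, where it would read
    [1 < 1]. *)
Lemma uabs_coef_prod_gt (rho : R) (s : seq K) :
  0 <= rho -> all (fun x => rho < v x) s ->
  let B := \prod_(x <- s) ('X - x%:P) in
  [/\ 0 < v B`_0, forall i, v B`_i.+1 * rho ^+ i.+1 < v B`_0
    & (0 < size s)%N -> rho ^+ size s < v B`_0].
Proof.
move=> rho0; elim: s => [_|x s IHs /= /andP[hx /IHs[/= B0 Bi Bs]]] /=.
  by rewrite big_nil coef1 uabs1; split=> // i; rewrite coef1 uabs0 mul0r.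
have x0 : 0 < v x := le_lt_trans rho0 hx.
rewrite big_cons; set B := \prod_(_ <- s) _ in B0 Bi Bs *.
have -> : v (('X - x%:P) * B)`_0 = v x * v B`_0.
  by rewrite coef_XsubC_mul sub0r uabsN uabsM.
split=> [|i|_]; first exact: mulr_gt0.
- have hi : v B`_i * rho ^+ i <= v B`_0.
    by case: i => [|i]; [rewrite expr0 mulr1 | exact: ltW].
  (* The case [rho = 0] is split off because the bound is divided by [rho ^+ i.+1] below. *)
  rewrite coef_XsubC_mul; have [->|rhoN0] := eqVneq rho 0.
    by rewrite expr0n mulr0 mulr_gt0.
  have rhoi : 0 < rho ^+ i.+1 by rewrite exprn_gt0 // lt_neqAle eq_sym rhoN0.
  rewrite -ltr_pdivlMr //; apply: uabsD_lt; rewrite ltr_pdivlMr //.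
    rewrite exprS mulrCA; apply: le_lt_trans (_ : rho * v B`_0 < _).
      exact: ler_wpM2l.
    by rewrite ltr_pM2r.
  by rewrite uabsN uabsM -mulrA ltr_pM2l.
(* The induction hypothesis is silent on an empty tail; there the claim is just [rho < v x]. *)
- rewrite exprS; case: (posnP (size s)) => [/size0nil s0|/Bs hs].
    by rewrite /B s0 big_nil coef1 uabs1 !mulr1.
  by rewrite ltr_pM ?exprn_ge0.
Qed.

(* The coefficient whose index is the number of small roots is dominated by the
   product of the large ones: this is a vertex of the Newton polygon. *)
Lemma uabs_coef_vertex (rho : R) (s : seq K) (m := count (fun x => v x <= rho) s) :
  0 <= rho -> (m < size s)%N ->
  rho ^+ (size s - m) < v (\prod_(x <- s) ('X - x%:P))`_m.
Proof.
move=> rho0 hm; pose small := fun x => v x <= rho.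
set A := \prod_(x <- filter small s) ('X - x%:P).
set B := \prod_(x <- filter (predC small) s) ('X - x%:P).
have sA : size (filter small s) = m by rewrite size_filter.
have sB : size (filter (predC small) s) = (size s - m)%N.
  by rewrite size_filter -(count_predC small s) addKn.
have -> : \prod_(x <- s) ('X - x%:P) = B * A.
  by rewrite (bigID small) /= mulrC /A /B !big_filter.
have large : all (fun x => rho < v x) (filter (predC small) s).
  by apply/allP => x; rewrite mem_filter /= -ltNge => /andP[].
have [/= B0 Bi Bs] := uabs_coef_prod_gt rho0 large.
rewrite -/B sB subn_gt0 in B0 Bi Bs.
have Am : A`_m = 1.
  have /monicP := monic_prod_XsubC (filter small s) xpredT id.
  by rewrite -/A lead_coefE size_prod_XsubC /= sA.
(* The first term of the convolution is
   [B]_0[, since]A[is monic of degree]m[. Any other term pairs]B[_i.+1] with a coefficient of [A] of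
   norm at most [rho ^+ i.+1], so it is strictly smaller. *)
rewrite coefM big_ord_recl /= subn0 Am mulr1 uabsD_dominant; first exact: Bs.
apply: uabs_sum_lt => // i _; rewrite uabsM.
apply: le_lt_trans (Bi i); apply: ler_wpM2l; first exact: uabs_ge0.
apply: le_trans (uabs_coef_prod_le _ (filter_all small s)) _.
by rewrite sA /bump /= add1n subKn.
Qed.

(** The core argument with centre 0 and monic products; the condition on [rho] uses powers, so no
    real exponents occur. *)
Lemma crit_points_count (rho r : R) (n k : nat) (s t : seq K) :
  0 <= rho -> n%:R != 0 :> K -> size s = n -> size t = n.-1 ->
  all (fun x => v x <= r) s ->
  (\prod_(x <- s) ('X - x%:P))^`() = n%:R *: \prod_(x <- t) ('X - x%:P) ->
  (k <= n.-1)%N ->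
  (forall j, (1 <= j <= k)%N -> v (j%:R / n%:R) * r ^+ (n - j) <= rho ^+ (n - j)) ->
  (k <= count (fun x => (v x <= rho)%R) t)%N.
Proof.
move=> rho0 n0 sn tn hs hder hk hrho; rewrite leqNgt; apply/negP.
set m := count _ _ => mk.
have mn : (m < n.-1)%N := leq_trans mk hk.
have := @uabs_coef_vertex rho t rho0; rewrite tn -/m => /(_ mn).
have {mn}-> : (n.-1 - m = n - m.+1)%N by rewrite -subn1 -subnDA.
apply/negP; rewrite -leNgt; apply: le_trans (hrho m.+1 _); last by [].
(* Comparison of the coefficients of [X^m] in [hder]. *)
have -> : (\prod_(x <- t) ('X - x%:P))`_m =
          (m.+1%:R / n%:R) * (\prod_(x <- s) ('X - x%:P))`_m.+1.
  apply: (mulfI n0); rewrite -coefZ -hder coef_deriv.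
  by rewrite mulrA mulrCA divff // mulr1 mulr_natl.
rewrite uabsM ler_wpM2l ?uabs_ge0 // -sn.
exact: uabs_coef_prod_le.
Qed.

End Ultrametric.

Lemma prod_XsubC_comp_shift (K : fieldType) (a : K) (m : nat) (f : 'I_m -> K) :
  (\prod_(i < m) ('X - (f i)%:P)) \Po ('X + a%:P) =
  \prod_(x <- [seq f i - a | i <- enum 'I_m]) ('X - x%:P).
Proof.
rewrite rmorph_prod big_map big_enum /=; apply: eq_bigr => i _.
by rewrite comp_polyB comp_polyX comp_polyC polyCB opprB addrA addrAC.
Qed.

(** Characteristic zero passes from the rationals along the three field embeddings. *)
Lemma padicComplex_natr_neq0 (R : realType) (p : nat) (C : padicComplex R p) n :
  (0 < n)%N -> n%:R != 0 :> C.
Proof.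
move=> n0.
rewrite -(rmorph_nat (Cp_inj C)) -(rmorph_nat (Qpbar_inj C)).
by rewrite -(rmorph_nat (Qp_inj C)) !fmorph_eq0 pnatr_eq0 -lt0n.
Qed.

Lemma crit_radius_ge (R : realType) (p : nat) (C : padicComplex R p) n r k j :
  (1 <= j <= k)%N ->
  r * Cp_abs C (j%:R / n%:R) `^ (1 / (n - j)%:R) <= crit_radius C n r k.
Proof.
move=> hj; pose F i := r * Cp_abs C (i%:R / n%:R) `^ (1 / (n - i)%:R).
have := @le_bigmax_seq _ R nat (index_iota 1 k.+1) 0 j xpredT F.
by apply=> //; rewrite mem_index_iota.
Qed.

Theorem theorem1 (R : realType) (p : nat) (hp : prime p) (C : padicComplex R p)
    (n : nat) (hn : (1 <= n)%N) (P : {poly C}) (hP : size P = n.+1)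
    (lambda : 'I_n -> C)
    (hlambda : P = lead_coef P *: \prod_(i < n) ('X - (lambda i)%:P))
    (a : C) (r : R) (hr : 0 <= r)
    (hdisk : forall i : 'I_n, lambda i \in disk a r)
    (omega : 'I_n.-1 -> C)
    (homega : P^`() =
       (n%:R * lead_coef P) *: \prod_(i < n.-1) ('X - (omega i)%:P)) :
  forall k : nat, (1 <= k <= n.-1)%N ->
    (k <= #|[set i : 'I_n.-1 | omega i \in disk a (crit_radius C n r k)]|)%N.
Proof.
move=> k /andP[k1 kn]; set rho := crit_radius C n r k.
pose s := [seq lambda i - a | i <- enum 'I_n].
pose t := [seq omega i - a | i <- enum 'I_n.-1].
have rho0 : 0 <= rho.
  (* The term [j = 1], available since [k >= 1], is nonnegative and bounds [rho] from below. *)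
  have hj : (1 <= 1 <= k)%N by [].
  by apply: le_trans (crit_radius_ge C n r hj); rewrite mulr_ge0 ?powR_ge0.
have lc0 : lead_coef P != 0 by rewrite lead_coef_eq0 -size_poly_eq0 hP.
have -> : #|[set i | omega i \in disk a rho]| =
          count (fun x => Cp_abs C x <= rho) t.
  by rewrite cardsE cardE /enum_mem size_filter count_map -enumT.
apply: (@crit_points_count _ _ (Cp_abs C) rho r n k s t) => //.
- exact: padicComplex_natr_neq0.
- by rewrite size_map size_enum_ord.
- by rewrite size_map size_enum_ord.
- by apply/allP => _ /mapP[i _ ->]; exact: hdisk.
- rewrite /s /t -!prod_XsubC_comp_shift deriv_comp.
  rewrite derivD derivX derivC addr0 mulr1 -comp_polyZ; congr (_ \Po _).
  apply: (scalerI lc0); rewrite -derivZ -hlambda homega scalerA.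
  by rewrite mulrC.
- move=> j hj; have nj : (0 < n - j)%N.
    have /andP[_ jk] := hj; rewrite subn_gt0 (leq_ltn_trans jk) //.
    by rewrite (leq_ltn_trans kn) // prednK.
  set c := Cp_abs C _; have c0 : 0 <= c by exact: uabs_ge0.
  (* Since [n - j > 0], the real root in the radius is undone by an integer power. *)
  have {1}-> : c = (c `^ (1 / (n - j)%:R)) ^+ (n - j).
    rewrite -powR_mulrn ?powR_ge0 // -powRrM mul1r mulVf ?powRr1 //.
    by rewrite pnatr_eq0 -lt0n.
  rewrite mulrC -exprMn; apply: lerXn2r; rewrite ?nnegrE ?mulr_ge0 ?powR_ge0 //.
  exact: crit_radius_ge.
Qed.
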